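(* Let $G=(V,E)$ be a graph which is an $n$-convex geometry. Then $G$ admits a star if and only if $|V|$ is odd.
   Context: All graphs are finite, simple and undirected, with non-empty vertex set. For a graph $G=(V,E)$ and $x\in V$, the closed neighbourhood of $x$ is $N[x]=\{x\}\cup\{y\in V:\{x,y\}\in E\}$. A star of $G$ is a vertex $s$ with $N[s]=V$ (in particular the vertex of the one-vertex graph is a star). For $Y\subseteq V$, the common closed neighbourhood is $N[Y]=\bigcap_{y\in Y}N[y]$ if $Y\neq\varnothing$, and $N[\varnothing]=V$. The neighbourhood convexity of $G$ is the family $n_G=\{N[Y]:Y\subseteq V\}\cup\{\varnothing\}$ of subsets of $V$; it contains $\varnothing$ and $V$ and is closed under intersection. Its members are called $n$-convex sets. For $X\subseteq V$ the convex hull $[X]_{n}$ is the intersection of all $n$-convex sets containing $X$. For an $n$-convex set $K$, $\operatorname{ex}(K)=\{x\in K: K\setminus\{x\}\in n_G\}$ is the set of extreme points of $K$. $G$ is an $n$-convex geometry if $K=[\operatorname{ex}(K)]_{n}$ for every $n$-convex set $K$. *)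

(* Defs.v *)
From mathcomp Require Import all_boot.

Set Implicit Arguments.
Unset Strict Implicit.
Unset Printing Implicit Defensive.

(* A finite simple undirected graph is a symmetric and
   irreflexive relation [e] on a finType [V]. *)

Definition closed_nbhd (V : finType) (e : rel V) (x : V) : {set V} :=
  x |: [set y | e x y].

Definition is_star (V : finType) (e : rel V) (s : V) : Prop :=
  closed_nbhd e s = [set: V].

(* The empty intersection is [set: V]: N[set0] = V. *)
Definition common_nbhd (V : finType) (e : rel V) (Y : {set V}) : {set V} :=
  \bigcap_(y in Y) closed_nbhd e y.

Definition nbhd_convexity (V : finType) (e : rel V) : {set {set V}} :=
  set0 |: [set common_nbhd e Y | Y : {set V}].

(* The family always contains [set: V], so this intersection is never empty. *)
Definition n_hull (V : finType) (e : rel V) (X : {set V}) : {set V} :=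
  \bigcap_(K in nbhd_convexity e | X \subset K) K.

Definition extreme_points (V : finType) (e : rel V) (K : {set V}) : {set V} :=
  [set x in K | K :\ x \in nbhd_convexity e].

Definition n_convex_geometry (V : finType) (e : rel V) : Prop :=
  forall K : {set V}, K \in nbhd_convexity e ->
    K = n_hull e (extreme_points e K).

(* Main.v *)
(** Write [N] for [common_nbhd e]. It is an order-reversing Galois connection
    of sets of vertices with itself, and [N setT] is the set of stars. In a
    convex geometry one can descend from a closed set [B] to any closed
    [A \subset B] by removing one vertex at a time, and each such step strictly
    enlarges [N]. Hence [#|B| + #|N B| <= #|A| + #|N A|]; as [N] exchanges
    [setT] and [N setT], the sum [#|K| + #|N K|] is the same for all closed [K].
    A maximal clique [K] satisfies [N K = K], so [2 #|K| = #|V| + #|N setT|],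
    and there is at most one star. *)

Require Import Defs.
From mathcomp Require Import all_boot.

Section NeighbourhoodConvexity.

Set Implicit Arguments.
Unset Strict Implicit.

Variables (V : finType) (e : rel V).
Hypotheses (e_sym : symmetric e) (geom : n_convex_geometry e).

Local Notation N := (common_nbhd e).

Lemma in_closed_nbhd x y : (y \in closed_nbhd e x) = (y == x) || e x y.
Proof. by rewrite !inE. Qed.

Lemma closed_nbhdC x y : (y \in closed_nbhd e x) = (x \in closed_nbhd e y).
Proof. by rewrite !in_closed_nbhd eq_sym e_sym. Qed.

Lemma common_nbhdP (Y : {set V}) x :
  reflect {in Y, forall y, x \in closed_nbhd e y} (x \in N Y).
Proof. exact: bigcapP. Qed.

(** Both sides say that each vertex of [A] equals or is adjacent to each vertex of [B]. *)
Lemma common_nbhd_galois (A B : {set V}) : (A \subset N B) = (B \subset N A).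
Proof.
by apply/subsetP/subsetP => sAB x xX; apply/common_nbhdP => y yY;
  rewrite closed_nbhdC; apply: (common_nbhdP _ _ (sAB _ yY)).
Qed.

Lemma common_nbhdKsub (A : {set V}) : A \subset N (N A).
Proof. by rewrite common_nbhd_galois. Qed.

Lemma common_nbhdS (A B : {set V}) : A \subset B -> N B \subset N A.
Proof.
by move=> sAB; rewrite common_nbhd_galois (subset_trans sAB) ?common_nbhdKsub.
Qed.

Lemma common_nbhd3 (A : {set V}) : N (N (N A)) = N A.
Proof.
by apply/eqP; rewrite eqEsubset common_nbhdKsub common_nbhdS ?common_nbhdKsub.
Qed.

Lemma common_nbhd_convex (A : {set V}) : N A \in nbhd_convexity e.
Proof. by rewrite !inE imset_f ?orbT. Qed.

(* A convex set is closed for [N \o N], except [set0] when there is a star. *)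
Lemma convex_closed (B : {set V}) :
  B \in nbhd_convexity e -> N setT \subset B -> N (N B) = B.
Proof.
rewrite !inE => /orP[/eqP-> | /imsetP[Y _ ->] _]; last exact: common_nbhd3.
by rewrite subset0 => /eqP <-; rewrite common_nbhd3.
Qed.

(** If all extreme points of [B] lay in [A], so would their hull, which is [B]. *)
Lemma convex_extreme_point (A B : {set V}) :
    A \in nbhd_convexity e -> B \in nbhd_convexity e -> ~~ (B \subset A) ->
  exists x, [/\ x \in B, x \notin A & B :\ x \in nbhd_convexity e].
Proof.
move=> convA convB.
case: (boolP (extreme_points e B \subset A)) => [sA | /subsetPn[x]].
  by rewrite {1}(geom convB) /n_hull (bigcap_inf A) ?convA.
by rewrite inE => /andP[Bx convBx] A'x _; exists x.
Qed.

Lemma closed_card_leq (A B : {set V}) :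
    N (N A) = A -> N (N B) = B -> A \subset B ->
  #|B| + #|N B| <= #|A| + #|N A|.
Proof.
move=> NNA; have [n] := ubnP #|B|; elim: n => // n IHn in B * => ltBn NNB sAB.
have [sBA | nsBA] := boolP (B \subset A).
  by have/eqP-> : A == B by rewrite eqEsubset sAB.
have convA : A \in nbhd_convexity e by rewrite -NNA common_nbhd_convex.
have convB : B \in nbhd_convexity e by rewrite -NNB common_nbhd_convex.
have [x [Bx A'x convBx]] := convex_extreme_point convA convB nsBA.
have sABx : A \subset B :\ x by rewrite subsetD1 sAB.
(* [B :\ x] contains [N setT] because [A] does, which rules out the exceptional case of [set0]. *)
have NNBx : N (N (B :\ x)) = B :\ x.
  apply: convex_closed convBx (subset_trans _ sABx).
  by rewrite -NNA common_nbhdS ?subsetT.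
have cardB : #|B| = #|B :\ x|.+1 by rewrite (cardsD1 x B) Bx.
have ltN : #|N B| < #|N (B :\ x)|.
  apply: proper_card; rewrite properEneq common_nbhdS ?subsetDl // andbT.
  (* Equal images under [N] would give [B :\ x = B], both sets being closed. *)
  apply/eqP => eqN; have := setD11 x B.
  by rewrite -NNBx -eqN NNB Bx.
apply: leq_trans (IHn _ _ NNBx sABx); last by rewrite -ltnS -cardB.
by rewrite cardB addSnnS leq_add2l.
Qed.

(** [K] lies between [N setT] and [setT]; comparing it with each of them gives the two
    inequalities. *)
Lemma closed_card_eq (K : {set V}) :
  N (N K) = K -> #|K| + #|N K| = #|V| + #|N setT|.
Proof.
move=> NNK; have NNT : N (N setT) = setT.
  by apply/eqP; rewrite eqEsubset subsetT common_nbhdKsub.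
apply/eqP; rewrite eqn_leq -cardsT; apply/andP; split; last first.
  by rewrite closed_card_leq.
rewrite addnC [leqRHS]addnC -{2}NNT addnC closed_card_leq ?common_nbhd3 //.
by rewrite -NNK common_nbhdS.
Qed.

(** Every [N Y] contains [N setT], so deleting an extreme point from [N setT] can only leave
    [set0]. *)
Lemma card_stars : #|N setT| <= 1.
Proof.
have [-> | /set0Pn[y Ny]] := eqVneq (N setT) set0; first by rewrite cards0.
have conv0 : set0 \in nbhd_convexity e by rewrite !inE eqxx.
have [|x [Nx _ convNx]] := convex_extreme_point conv0 (common_nbhd_convex setT).
  by rewrite subset0; apply/set0Pn; exists y.
move: convNx; rewrite (cardsD1 x) Nx in_setU1.
case/orP => [/eqP-> | /imsetP[Y _ NY]]; first by rewrite cards0.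
by have/subsetP/(_ x Nx) := common_nbhdS (subsetT Y); rewrite -NY setD11.
Qed.

(* The witness is a maximal clique. *)
Lemma exists_common_nbhd_fixpoint : exists K : {set V}, N K = K.
Proof.
pose clique (K : {set V}) := K \subset N K.
have [|K /maxsetP[cK maxK] _] := @maxset_exists _ clique set0; first exact: sub0set.
exists K; apply/eqP; rewrite eqEsubset andbC; apply/andP; split=> //.
(* A vertex of [N K] extends [K] to a clique, so by maximality it already lies in [K]. *)
apply/subsetP => x NKx; rewrite -(maxK (x |: K)) ?setU11 ?subsetUr //.
have xNx : x \in N (x |: K).
  apply/common_nbhdP => y /setU1P[-> | Ky]; first by rewrite setU11.
  exact: (common_nbhdP _ _ NKx).
rewrite /clique subUset sub1set xNx common_nbhd_galois subUset sub1set NKx.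
exact: cK.
Qed.

Lemma is_starP s : is_star e s <-> s \in N setT.
Proof.
split=> [star_s | /common_nbhdP Ns].
  by apply/common_nbhdP => y _; rewrite closed_nbhdC star_s.
by apply/setP => y; rewrite closed_nbhdC Ns !inE.
Qed.

End NeighbourhoodConvexity.

Theorem corollary38 (V : finType) (e : rel V)
    (e_sym : symmetric e) (e_irr : irreflexive e)
    (V_nonempty : 0 < #|V|)
    (geom : n_convex_geometry e) :
  (exists s : V, is_star e s) <-> odd #|V|.
Proof.
have [K NK] := exists_common_nbhd_fixpoint e_sym.
have NNK : common_nbhd e (common_nbhd e K) = K by rewrite !NK.
(* The sum is [2 #|K|], so [#|V|] and the number of stars have the same parity. *)
have := closed_card_eq e_sym geom NNK.
rewrite NK => /(congr1 odd); rewrite addnn odd_double oddD => /esym/negbT.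
rewrite negb_add => /eqP.
have card_le1 := card_stars e_sym geom.
have -> : odd #|common_nbhd e setT| = (0 < #|common_nbhd e setT|).
  by case: #|_| card_le1 => [|[]].
rewrite card_gt0 => oddV.
split=> [[s /(is_starP e_sym) Ns] | ].
  by rewrite oddV; apply/set0Pn; exists s.
by rewrite oddV => /set0Pn[s /(is_starP e_sym)]; exists s.
Qed.
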